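(* Let $\mathcal{X}\subseteq\mathbb{R}^d$ be a convex set, let $\mathcal{S}$ be the state space and let $\mathcal{S}_D\subseteq\mathcal{S}$ be a compact subset. Let $F(x,s,z)$ be a real-valued objective function, let $(S_i,Z(\omega_{i+1}))_{i\ge 0}$ be a sequence of random state-outcome observations, and let $(w_n(s,S_i))_{i=0}^{n-1}$, $n\ge 1$, be nonnegative weights with $\sum_{i=0}^{n-1}w_n(s,S_i)=1$. Define $$\bar F_n(x|s)=\sum_{i=0}^{n-1}w_n(s,S_i)\,F(x,S_i,Z(\omega_{i+1})),\qquad F(x|s)=\mathbb{E}[F(x,s,Z)\mid S=s].$$ Assume: (1) for every $s\in\mathcal{S}_D$, the function $x\mapsto F(x,s,Z(\omega))$ is almost surely convex and continuous on $\mathcal{X}$; (2) for every fixed $s\in\mathcal{S}_D$ and $x\in\mathcal{X}$, the weights and the distribution of $(Z,S)$ are such that $\lim_{n\to\infty}\sum_{i=0}^{n-1}w_n(s,S_i)F(x,S_i,Z(\omega_{i+1}))=F(x|s)$ almost surely; (3) for every fixed $s\in\mathcal{S}_D$, the function $x\mapsto F(x|s)$ has a unique minimizer over $\mathcal{X}$. Let $x_n^*(s)\in\arg\min_{x\in\mathcal{X}}\bar F_n(x|s)$ be a solution of the approximate problem and let $x^*(s)=\arg\min_{x\in\mathcal{X}}F(x|s)$ be the true optimal decision. Then, for every $s\in\mathcal{S}_D$, $x_n^*(s)\to x^*(s)$ almost surely as $n\to\infty$.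
   Context: Setting (stochastic search with an observable state variable): a random state $S$ taking values in $\mathcal{S}$ is observed, a decision $x\in\mathcal{X}$ is made, and then a random outcome $Z$ (a random variable on a probability space $\Omega$ with values in a set $\Psi$), whose distribution may depend on the state, is realized; the cost is $F(x,S,Z)$. At iteration $i$ the observed state is $S_i$ and the outcome revealed afterwards is $Z(\omega_{i+1})$; the whole function $x\mapsto F(x,S_i,Z(\omega_{i+1}))$ is then known. The weights $w_n(s,S_i)$ depend on the query state $s$ and the observed states, and the weight functions may change with $n$. Standing assumptions: $F(x,S_i,Z(\omega_{i+1}))$ is convex in $x$ for every $S_i$ and $\omega_{i+1}$, so that $\bar F_n(\cdot|s)$ is convex. The minimizer $x_n^*(s)$ of $\bar F_n(\cdot|s)$ over $\mathcal{X}$ is taken to exist.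
   Formalization: The set X is also assumed to be locally closed (an intersection of an open and a closed set), since for a general convex X, such as {x2 > 0} ∪ {(0,0)} in the plane, the claim fails; F(x,s,·) is assumed integrable under the conditional law so that F(x|s) is defined. *)

(* Defs.v *)
From HB Require Import structures.
From mathcomp Require Import all_boot all_order all_algebra.
From mathcomp Require Import all_classical all_reals all_analysis.

Set Implicit Arguments.
Unset Strict Implicit.
Unset Printing Implicit Defensive.

Import Order.TTheory GRing.Theory Num.Theory.
Import numFieldNormedType.Exports.

Local Open Scope classical_set_scope.
Local Open Scope ring_scope.

Notation borel T := (g_sigma_algebraType (@open T)).

Definition argmin {R : realType} {V : Type} (X : set V) (f : V -> R) : set V :=
  [set x | X x /\ forall y, X y -> f x <= f y].

(* Both closed sets and open sets are locally closed. *)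
Definition locally_closed {T : topologicalType} (X : set T) : Prop :=
  exists U C : set T, [/\ open U, closed C & X = U `&` C].

(* Q is a (regular) conditional distribution of Z given S. *)
Definition conditional_law {d d1 d2} {Omega : measurableType d}
    {T : measurableType d1} {Psi : measurableType d2} {R : realType}
    (P : probability Omega R) (S : {RV P >-> T}) (Z : {RV P >-> Psi})
    (Q : R.-pker T ~> Psi) : Prop :=
  forall (A : set T) (B : set Psi), measurable A -> measurable B ->
    P (S @^-1` A `&` Z @^-1` B) =
      (\int[P]_(omega in S @^-1` A) Q (S omega) B)%E.

(* E[F(x, s, Z) | S = s], where Q s is the law of Z given S = s. *)
Definition cond_cost {d1 d2} {T : measurableType d1} {Psi : measurableType d2}
    {R : realType} {V : Type} (Q : R.-pker T ~> Psi) (F : V -> T -> Psi -> R)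
    (s : T) (x : V) : R :=
  \int[Q s]_z F x s z.

(* The weight of the i-th observation may depend on n, on the query state and
   on all the observed states S_0, ..., S_{n-1} (as it does for normalized
   kernel weights).  The outcome paired with the state S_i is Z_{i+1}. *)
Definition avg_cost {R : realType} {V T Psi : Type}
    (F : V -> T -> Psi -> R) (w : forall n, T -> ('I_n -> T) -> 'I_n -> R)
    (S_ : nat -> T) (Z_ : nat -> Psi) (n : nat) (s : T) (x : V) : R :=
  \sum_(i < n) w n s (fun j => S_ j) i * F x (S_ i) (Z_ i.+1).

(* Main.v *)
(* If x_n does not converge to the minimizer p, then on the segments [p, x_n]
   there are points y_n at a fixed small distance from p with
   Fbar_n(y_n) <= Fbar_n(p); as X is locally closed, they accumulate at some
   y <> p of X.  Fix a simplex spanning X and the countable grid of points with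
   rational coordinates in it, on which Fbar_n converges almost surely.  A grid
   point q = (1 - t) y + t h, with h well inside the simplex, is also
   (1 - t) y_n + t h_n with h_n in the simplex as soon as y_n is near y, so by
   convexity Fbar_n(q) <= (1 - t) Fbar_n(p) + t B_n, where B_n is controlled by
   the vertices.  Letting n tend to infinity, then t to 0 (dominated
   convergence along the cone from y to the simplex), F(y|s) <= F(p|s), which
   contradicts the uniqueness of the minimizer. *)
Require Import Defs.
From HB Require Import structures.
From mathcomp Require Import all_boot all_order all_algebra.
From mathcomp Require Import all_classical all_reals all_analysis.
From mathcomp Require Import ring lra.

Set Implicit Arguments.
Unset Strict Implicit.
Unset Printing Implicit Defensive.

Import Order.TTheory GRing.Theory Num.Theory.
Import numFieldNormedType.Exports.

Local Open Scope classical_set_scope.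
Local Open Scope ring_scope.

(** * Convex combinations and spanning directions *)

Lemma convex_set_conv (R : numDomainType) (E : lmodType R) (X : set E) (x y : E)
    (t : R) :
  convex_set X -> 0 <= t -> t <= 1 -> X x -> X y -> X (t *: x + (1 - t) *: y).
Proof.
move=> cX t0 t1 /mem_set Xx /mem_set Xy; apply: set_mem.
exact: (cX x y (Itv01 t0 t1)).
Qed.

Lemma convex_function_conv (R : numFieldType) (E : lmodType R) (X : set E)
    (f : E -> R) (x y : E) (t : R) :
  convex_function X f -> 0 <= t -> t <= 1 -> X x -> X y ->
  f (t *: x + (1 - t) *: y) <= t * f x + (1 - t) * f y.
Proof.
move=> cf t0 t1 /mem_set Xx /mem_set Xy.
exact: (cf (Itv01 t0 t1) x y).
Qed.

Lemma convex_sublevel (K : numFieldType) (E : lmodType K)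
    (X : set E) (f : E -> K) (B : K) :
  convex_set X -> convex_function X f -> convex_set [set x | X x /\ f x <= B].
Proof.
move=> cX cf x y t; rewrite !inE /= => -[Xx fx] [Xy fy].
have t0 : 0 <= t%:num :> K by exact: ge0.
have t1 : t%:num <= 1 :> K by exact: le1.
split; first exact: (convex_set_conv cX t0 t1).
apply: le_trans (convex_function_conv cf t0 t1 Xx Xy) _.
rewrite (_ : B = t%:num * B + (1 - t%:num) * B); last by ring.
by rewrite lerD// ler_wpM2l// subr_ge0.
Qed.

(** Induction on the number of vertices: the last one is split off and the other coefficients are
    rescaled by [1 - cn]. The strict bound on the sum keeps this factor positive; the missing mass
    is the weight of [v0]. *)
Lemma convex_set_simplex (R : realFieldType) (E : lmodType R) (C : set E)
    (v0 : E) (n : nat) (v : 'I_n -> E) (c : 'I_n -> R) :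
  convex_set C -> C v0 -> (forall i, C (v0 + v i)) ->
  (forall i, 0 <= c i) -> \sum_i c i < 1 ->
  C (v0 + \sum_i c i *: v i).
Proof.
move=> cC C0; elim: n v c => [|n IHn] v c Cv c0.
  by rewrite !big_ord0 addr0.
rewrite !big_ord_recr /=; set cn := c ord_max; set w := widen_ord _ => s1.
have s0 : 0 <= \sum_(i < n) c (w i) by rewrite sumr_ge0.
have cn1 : 0 < 1 - cn by lra.
have cnE : (1 - cn) *: (\sum_(i < n) (c (w i) / (1 - cn)) *: v (w i)) =
    \sum_(i < n) c (w i) *: v (w i).
  rewrite scaler_sumr; apply: eq_bigr => i _.
  by rewrite scalerA mulrC divfK ?gt_eqF.
have : C (v0 + \sum_(i < n) (c (w i) / (1 - cn)) *: v (w i)).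
  apply: IHn => // [i|]; first by rewrite divr_ge0// ltW.
  by rewrite -mulr_suml ltr_pdivrMr// mul1r; lra.
have cnle1 : cn <= 1 by lra.
move=> /(convex_set_conv cC (c0 ord_max) cnle1 (Cv ord_max)); congr (C _).
rewrite !scalerDr cnE addrACA -scalerDl subrKC scale1r.
by congr (_ + _); rewrite addrC.
Qed.

(* Rank maximality: a difference outside the row space could be appended. *)
Lemma exists_spanning_rows (F : fieldType) (d : nat) (X : set 'rV[F]_d)
    (v0 : 'rV[F]_d) :
  exists m (V : 'M[F]_(m, d)), (forall i, X (v0 + row i V)) /\
    forall x, X x -> (x - v0 <= V)%MS.
Proof.
apply: contrapT => H.
suff /(_ d.+1)[m [V [_]]] : forall k, exists m (V : 'M[F]_(m, d)),
    (forall i, X (v0 + row i V)) /\ (k <= \rank V)%N.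
  by rewrite leqNgt ltnS rank_leq_col.
elim=> [|k [m [V [XV kV]]]].
  by exists 0%N, 0; split => // -[].
have [x [Xx xV]] : exists x, X x /\ ~ (x - v0 <= V)%MS.
  apply: contrapT => /forallNP Hx; apply: H; exists m, V; split => // x Xx.
  by apply: contrapT => xV; exact: (Hx x).
exists (1 + m)%N, (col_mx (x - v0) V); split => [i|].
  case: (split_ordP i) => j ->.
    by rewrite rowKu row_id// addrC subrK.
  by rewrite rowKd.
apply: (leq_ltn_trans kV) ;  rewrite -addsmxE rank_ltmx// ltmxE.
by rewrite addsmxSr addsmx_sub submx_refl andbT; apply/negP.
Qed.

(** * Sup-norm estimates for row vectors *)

Lemma row_norm_ge (R : realFieldType) (n : nat) (u : 'rV[R]_n) (i : 'I_n) :
  `|u ord0 i| <= `|u|.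
Proof.
rewrite [leRHS](mx_normrE u).
exact: (le_bigmax _ (fun ij => `|u ij.1 ij.2|) (ord0, i)).
Qed.

Lemma row_norm_le (R : realFieldType) (n : nat) (u : 'rV[R]_n) (M : R) :
  0 <= M -> (forall i, `|u ord0 i| <= M) -> `|u| <= M.
Proof.
move=> M0 uM; rewrite [leLHS](mx_normrE u).
by apply: bigmax_le => // -[i j] _ /=; rewrite (ord1 i).
Qed.

Lemma mulmx_norm_bound (R : realFieldType) (m n : nat) (A : 'M[R]_(m, n)) :
  exists2 K, 0 < K & forall u : 'rV[R]_m, `|u *m A| <= K * `|u|.
Proof.
(* The added 1 keeps the constant positive even for a zero matrix, so that it can serve as a
   divisor. *)
exists (1 + \sum_i \sum_j `|A i j|) => [|u].
  by rewrite ltr_pwDl// sumr_ge0// => i _; rewrite sumr_ge0.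
apply: row_norm_le => [|j].
  rewrite mulr_ge0// addr_ge0// sumr_ge0// => i _.
  by rewrite sumr_ge0.
rewrite mxE (le_trans (ler_norm_sum _ _ _))//.
rewrite mulrDl mul1r ler_wpDl// mulr_suml ler_sum// => k _.
rewrite normrM mulrC ler_pM// ?row_norm_ge//.
by rewrite (bigD1 j)//= lerDl sumr_ge0.
Qed.

(** * Uniform bounds for convex functions on a spanning simplex *)

(** A sum of absolute values dominates the maximum over the vertices, and limits and integrability
    pass through it term by term. *)
Definition vertex_bound (R : realType) (d m : nat) (v0 : 'rV[R]_d)
    (V : 'M[R]_(m, d)) (f : 'rV[R]_d -> R) : R :=
  `|f v0| + \sum_i `|f (v0 + row i V)|.

(* The simplex with vertices v0 and v0 + row i V spans X, and every point
   v0 + (c + e) *m V with `|e| <= delta lies in it; A recovers coordinates. *)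
Definition simplex_core (R : realType) (d m : nat) (X : set 'rV[R]_d)
    (v0 : 'rV[R]_d) (V : 'M[R]_(m, d)) (A : 'M[R]_(d, m)) (c : 'rV[R]_m)
    (delta : R) : Prop :=
  [/\ 0 < delta, X v0, forall i, X (v0 + row i V),
      forall x y, X x -> X y -> (x - y) *m A *m V = x - y &
      forall (e : 'rV[R]_m) (C : set 'rV[R]_d), `|e| <= delta ->
        convex_set C -> C v0 -> (forall i, C (v0 + row i V)) ->
        C (v0 + (c + e) *m V)].

Lemma exists_simplex_core (R : realType) (d : nat) (X : set 'rV[R]_d)
    (v0 : 'rV[R]_d) : X v0 ->
  exists m V A c delta, @simplex_core R d m X v0 V A c delta.
Proof.
move=> Xv0; have [m [V [XV spanV]]] := exists_spanning_rows X v0.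
(* The centre is the barycentre: all [m.+1] vertices get weight [b]. With a perturbation of at most
   [b ^+ 2] per coordinate, coefficients stay above [b - b ^+ 2 >= 0] and their sum stays below
   [m * (b + b ^+ 2) = 1 - b ^+ 2 < 1]. *)
pose b : R := m.+1%:R^-1.
have b0 : 0 < b by rewrite invr_gt0 ltr0n.
exists m, V, (pinvmx V), (const_mx b), (b ^+ 2); split => //.
- by rewrite exprn_gt0.
- move=> x y Xx Xy; apply: mulmxKpV.
  have -> : x - y = (x - v0) + (-1) *: (y - v0).
    by rewrite scaleN1r opprB addrC addrA subrK addrC.
  by rewrite addmx_sub ?scalemx_sub ?spanV.
move=> e C eb cC Cv0 CV; rewrite mulmx_sum_row.
have mb : m%:R * b = 1 - b.
  apply/eqP; rewrite -subr_eq opprK -[X in _ + X]mul1r -mulrDl natr1.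
  by rewrite mulfV// pnatr_eq0.
have b1 : b <= 1 by rewrite invf_le1 ?ltr0n// ler1n.
have eib i : `|e ord0 i| <= b ^+ 2 by apply: le_trans eb; exact: row_norm_ge.
apply: convex_set_simplex => // [i|].
  rewrite !mxE; have := eib i; rewrite ler_norml => /andP[ei _].
  by nra.
apply: (@le_lt_trans _ _ (\sum_(i < m) (b + b ^+ 2))).
  apply: ler_sum => i _; rewrite !mxE lerD2l.
  exact: le_trans (ler_norm _) (eib i).
rewrite sumr_const card_ord -mulr_natl mulrDr mb expr2 mulrA mb.
by nra.
Qed.

(** The sublevel set of [f] at height [vertex_bound v0 V f] is convex and contains the vertices,
    hence the core of the simplex. *)
Lemma simplex_core_convex (R : realType) (d m : nat) (X : set 'rV[R]_d)
    (v0 : 'rV[R]_d) (V : 'M[R]_(m, d)) (A : 'M[R]_(d, m)) (c : 'rV[R]_m)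
    (delta : R) (f : 'rV[R]_d -> R) (e : 'rV[R]_m) :
  simplex_core X v0 V A c delta -> convex_set X -> convex_function X f ->
  `|e| <= delta ->
  X (v0 + (c + e) *m V) /\ f (v0 + (c + e) *m V) <= vertex_bound v0 V f.
Proof.
move=> [d0 Xv0 XV _ core] cX cf ed.
have cC := convex_sublevel (B := vertex_bound v0 V f) cX cf.
apply: (core e [set x | X x /\ f x <= vertex_bound v0 V f]) => //.
  split => //; apply: le_trans (ler_norm _) _.
  by rewrite lerDl sumr_ge0.
move=> i; split => //; apply: le_trans (ler_norm _) _.
by rewrite /vertex_bound (bigD1 i)//= addrCA lerDl addr_ge0// sumr_ge0.
Qed.

Lemma convex_function_cst (R : realType) (d : nat) (X : set 'rV[R]_d) (a : R) :
  convex_function X (fun=> a).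
Proof. by move=> t x y _ _; rewrite convmm. Qed.

Lemma simplex_core_in (R : realType) (d m : nat) (X : set 'rV[R]_d)
    (v0 : 'rV[R]_d) (V : 'M[R]_(m, d)) (A : 'M[R]_(d, m)) (c : 'rV[R]_m)
    (delta : R) (e : 'rV[R]_m) :
  simplex_core X v0 V A c delta -> convex_set X -> `|e| <= delta ->
  X (v0 + (c + e) *m V).
Proof.
move=> core cX ed.
by have [] := simplex_core_convex core cX (@convex_function_cst _ _ X 0) ed.
Qed.

(* The point on the left is also the combination of y' and of a point of the
   simplex with the same weights, as long as y' is close to y. *)
Lemma simplex_core_perturb (R : realType) (d m : nat) (X : set 'rV[R]_d)
    (v0 : 'rV[R]_d) (V : 'M[R]_(m, d)) (A : 'M[R]_(d, m)) (c : 'rV[R]_m)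
    (delta : R) (y : 'rV[R]_d) (t : R) (e : 'rV[R]_m) :
  simplex_core X v0 V A c delta -> convex_set X -> X y -> 0 < t -> t <= 1 ->
  `|e| <= delta / 2 ->
  exists2 eta, 0 < eta & forall y', X y' -> `|y - y'| < eta ->
    forall f, convex_function X f ->
    f (t *: (v0 + (c + e) *m V) + (1 - t) *: y) <=
      t * vertex_bound v0 V f + (1 - t) * f y'.
Proof.
move=> core cX Xy t0 t1 ed; have [d0 _ _ coord _] := core.
have [K K0 AK] := mulmx_norm_bound A.
(* Chosen so that the correction term in [e'] has norm at most [delta / 2], the room left by [e]. It
   does not depend on [f]. *)
exists (t * (delta / 2) / K) => [|y' Xy' yy' f cf].
  by rewrite divr_gt0// mulr_gt0// divr_gt0.
(* The simplex point absorbs the displacement: weighted by [t], the correction contributes exactly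
   [(1 - t) *: (y - y')]. *)
pose e' := e + ((1 - t) / t) *: ((y - y') *m A).
have e'd : `|e'| <= delta.
  rewrite (le_trans (ler_normD _ _))// (splitr delta) lerD// normrZ.
  rewrite ger0_norm ?divr_ge0 ?subr_ge0// ?(ltW t0)//.
  have h1 : `|(y - y') *m A| <= t * (delta / 2).
    apply: le_trans (AK _) _; rewrite mulrC -ler_pdivlMr//; exact: ltW.
  have h2 : (1 - t) / t <= t^-1.
    by rewrite ler_piMl ?invr_ge0 ?(ltW t0)// lerBlDr lerDl ltW.
  apply: (le_trans (ler_pM _ _ h2 h1)) => //.
    by rewrite divr_ge0 ?subr_ge0// ltW.
  by rewrite mulKf// gt_eqF.
have -> : t *: (v0 + (c + e) *m V) + (1 - t) *: y =
    t *: (v0 + (c + e') *m V) + (1 - t) *: y'.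
  rewrite /e' addrA [in RHS]mulmxDl -scalemxAl coord// addrA.
  rewrite [in RHS]scalerDr scalerA mulrCA mulfV ?gt_eqF// mulr1 -addrA.
  by rewrite -scalerDr subrK.
have [Xu fu] := simplex_core_convex core cX cf e'd.
apply: le_trans (convex_function_conv cf (ltW t0) t1 Xu Xy') _.
by rewrite lerD2r ler_wpM2l// ltW.
Qed.

(** Reflect [q] through the centre [x0], shrinking by [r], to a point [u] of the simplex. Since [x0]
    lies between [q] and [u], convexity gives [(1 + r) * f x0 <= r * f q + f u], and [f u] is
    bounded by the vertices. *)
Lemma simplex_core_lower (R : realType) (d m : nat) (X : set 'rV[R]_d)
    (v0 : 'rV[R]_d) (V : 'M[R]_(m, d)) (A : 'M[R]_(d, m)) (c : 'rV[R]_m)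
    (delta rho : R) :
  simplex_core X v0 V A c delta -> convex_set X ->
  exists2 K, 0 <= K & forall q, X q -> `|q - (v0 + c *m V)| <= rho ->
    forall f, convex_function X f ->
    - f q <= K * (`|f (v0 + c *m V)| + vertex_bound v0 V f).
Proof.
move=> core cX; have [d0 _ _ coord _] := core.
have [K K0 AK] := mulmx_norm_bound A.
set x0 := v0 + c *m V.
have Xx0 : X x0.
  have := @simplex_core_in _ _ _ _ _ _ _ _ _ 0 core cX.
  by rewrite normr0 addr0; apply; exact: ltW.
pose r := delta / (K * (1 + `|rho|)).
have r0 : 0 < r by rewrite divr_gt0// mulr_gt0// ltr_pwDl.
have r1 : 0 < 1 + r by rewrite addr_gt0.
exists ((1 + r) / r) => [|q Xq qrho f cf].
  by rewrite divr_ge0 ?ltW.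
pose e := - r *: ((q - x0) *m A).
have ed : `|e| <= delta.
  rewrite normrZ normrN gtr0_norm// /r mulrAC ler_pdivrMr ?mulr_gt0 ?ltr_pwDl//.
  rewrite ler_pM2l//; apply: le_trans (AK _) _; rewrite ler_pM2l//.
  apply: le_trans qrho _; apply: le_trans (ler_norm _) _.
  by rewrite lerDr.
have [] := simplex_core_convex core cX cf ed.
have -> : v0 + (c + e) *m V = x0 - r *: (q - x0).
  by rewrite /e mulmxDl addrA -scalemxAl coord// scaleNr.
set u := _ - _ => Xu fu.
have mu0 : 0 <= r / (1 + r) by rewrite divr_ge0// ltW.
have mu1 : r / (1 + r) <= 1 by rewrite ler_pdivrMr// mul1r lerDr.
have := convex_function_conv cf mu0 mu1 Xq Xu.
have -> : (r / (1 + r)) *: q + (1 - r / (1 + r)) *: u = x0.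
  have -> : 1 - r / (1 + r) = (1 + r)^-1 by field; rewrite gt_eqF.
  rewrite (mulrC r) -scalerA -scalerDr /u scalerBr opprB.
  rewrite addrCA subrKC -{1}(scale1r x0) -scalerDl.
  by rewrite scalerA mulVf ?gt_eqF// scale1r.
have -> : 1 - r / (1 + r) = (1 + r)^-1 by field; rewrite gt_eqF.
move=> h.
have h1 : (1 + r) * f x0 <= r * f q + vertex_bound v0 V f.
  move: h; rewrite mulrAC -(mulrC (f u)) -mulrDl ler_pdivlMr// mulrC => h.
  by apply: le_trans h _; rewrite lerD2l.
rewrite mulrAC ler_pdivlMr//.
have := ler_norm (- f x0); rewrite normrN => n0.
have B0 : 0 <= vertex_bound v0 V f by rewrite addr_ge0// sumr_ge0.
by nra.
Qed.

(** * Passing to the limit on the rational grid *)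

Lemma rat_row_approx (R : realType) (m : nat) (u : 'rV[R]_m) (eps : R) :
  0 < eps -> exists r : 'rV[rat]_m, `|map_mx ratr r - u| <= eps.
Proof.
move=> eps0.
have H i : exists r : rat, `|ratr r - u ord0 i| <= eps.
  have /rat_in_itvoo[r /itvP ru] : u ord0 i - eps < u ord0 i + eps.
    by rewrite ltrBlDr -addrA ltrDl addr_gt0.
  by exists r; rewrite ler_distl !ru.
have [r rP] := choice H.
exists (\row_i r i); apply: row_norm_le => [|i]; first exact: ltW.
by rewrite !mxE.
Qed.

Lemma cvg_vertex_bound (R : realType) (d m : nat) (v0 : 'rV[R]_d)
    (V : 'M[R]_(m, d)) (f : nat -> 'rV[R]_d -> R) (g : 'rV[R]_d -> R) :
  f n v0 @[n --> \oo] --> g v0 ->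
  (forall i, f n (v0 + row i V) @[n --> \oo] --> g (v0 + row i V)) ->
  vertex_bound v0 V (f n) @[n --> \oo] --> vertex_bound v0 V g.
Proof.
move=> f0 fV; apply: cvgD; first exact: cvg_norm.
by apply: cvg_big => [|i _]; [exact: add_continuous | exact: cvg_norm].
Qed.

(** Were the inequality false, its strict converse would hold for [f n] at all large [n]. The radius
    [eta] being uniform over convex functions, some such [n] has a point [y'] within [eta] of [y]
    with [f n y' <= f n p], contradicting the perturbation bound. *)
Lemma frequently_le_limit (R : realType) (d m : nat) (X : set 'rV[R]_d)
    (v0 : 'rV[R]_d) (V : 'M[R]_(m, d)) (A : 'M[R]_(d, m)) (c : 'rV[R]_m)
    (delta : R) (f : nat -> 'rV[R]_d -> R) (g : 'rV[R]_d -> R)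
    (p y : 'rV[R]_d) (t : R) (e : 'rV[R]_m)
    (q := t *: (v0 + (c + e) *m V) + (1 - t) *: y) :
  simplex_core X v0 V A c delta -> convex_set X ->
  (\forall n \near \oo, convex_function X (f n)) ->
  X y -> 0 < t -> t <= 1 -> `|e| <= delta / 2 ->
  vertex_bound v0 V (f n) @[n --> \oo] --> vertex_bound v0 V g ->
  f n q @[n --> \oo] --> g q -> f n p @[n --> \oo] --> g p ->
  (forall eta N, 0 < eta -> exists n y',
    [/\ (N <= n)%N, X y', `|y - y'| < eta & f n y' <= f n p]) ->
  g q <= t * vertex_bound v0 V g + (1 - t) * g p.
Proof.
move=> core cX cf Xy t0 t1 ed fB fq fp freq.
have [eta eta0 H] := simplex_core_perturb core cX Xy t0 t1 ed.
rewrite leNgt; apply/negP => lt_g.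
have dif : f n q - (t * vertex_bound v0 V (f n) + (1 - t) * f n p)
    @[n --> \oo] --> g q - (t * vertex_bound v0 V g + (1 - t) * g p).
  apply: cvgB => //.
  by apply: cvgD; exact: cvgMr.
have {}dif : \forall n \near \oo,
    0 < f n q - (t * vertex_bound v0 V (f n) + (1 - t) * f n p).
  by apply: (cvgr_gt _ dif); rewrite subr_gt0.
have [N _ HN] := filterI cf dif.
have [n [y' [Nn Xy' yy' fy']]] := freq _ N eta0.
have [cfn] := HN n Nn; rewrite subr_gt0 ltNge => /negP; apply.
apply: le_trans (H y' Xy' yy' _ cfn) _.
by rewrite lerD2l ler_wpM2l// subr_ge0.
Qed.

(* y is approached by grid points inside the cone from y to the simplex. *)
Lemma epi_limit_le (R : realType) (d m : nat) (X : set 'rV[R]_d)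
    (v0 : 'rV[R]_d) (V : 'M[R]_(m, d)) (A : 'M[R]_(d, m)) (c : 'rV[R]_m)
    (delta : R) (f : nat -> 'rV[R]_d -> R) (g : 'rV[R]_d -> R)
    (p y : 'rV[R]_d) :
  simplex_core X v0 V A c delta -> convex_set X ->
  (\forall n \near \oo, convex_function X (f n)) ->
  X y ->
  (forall r : 'rV[rat]_m, X (v0 + map_mx ratr r *m V) ->
    f n (v0 + map_mx ratr r *m V) @[n --> \oo] -->
      g (v0 + map_mx ratr r *m V)) ->
  f n p @[n --> \oo] --> g p ->
  (forall (t : nat -> R) (e : nat -> 'rV[R]_m),
    (forall k, 0 < t k) -> (forall k, t k <= 1) ->
    t k @[k --> \oo] --> 0 -> (forall k, `|e k| <= delta) ->
    g (t k *: (v0 + (c + e k) *m V) + (1 - t k) *: y) @[k --> \oo] --> g y) ->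
  (forall eta N, 0 < eta -> exists n y',
    [/\ (N <= n)%N, X y', `|y - y'| < eta & f n y' <= f n p]) ->
  g y <= g p.
Proof.
move=> core cX cf Xy fgrid fp gy freq.
have [d0 Xv0 XV coord _] := core.
(* The vertices are grid points: [r = 0] gives [v0], and the unit rows give the others. *)
have fB : vertex_bound v0 V (f n) @[n --> \oo] --> vertex_bound v0 V g.
  apply: cvg_vertex_bound => [|i].
    by have := fgrid 0; rewrite map_mx0 mul0mx addr0; exact.
  by have := fgrid (delta_mx 0 i); rewrite map_delta_mx -rowE; exact.
have t0 k : 0 < (harmonic k : R) by rewrite invr_gt0 ltr0n.
have t1 k : (harmonic k : R) <= 1 by rewrite invf_le1 ?ltr0n// ler1n.
have H k : exists e : 'rV[R]_m, `|e| <= delta / 2 /\ exists r : 'rV[rat]_m,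
    harmonic k *: (v0 + (c + e) *m V) + (1 - harmonic k) *: y =
    v0 + map_mx ratr r *m V.
  set t : R := harmonic k.
  (* [u] holds the coordinates, relative to [v0], of the cone point with [e = 0]. A rational
     approximation within [t * (delta / 2)] becomes, after division by [t], an admissible [e]. *)
  pose u := t *: c + (1 - t) *: ((y - v0) *m A).
  have [|r ru] := @rat_row_approx _ _ u (t * (delta / 2)).
    by rewrite mulr_gt0 ?divr_gt0// t0.
  exists (t^-1 *: (map_mx ratr r - u)); split.
    rewrite normrZ gtr0_norm ?invr_gt0 ?t0// mulrC ler_pdivrMr ?t0//.
    by rewrite mulrC.
  exists r; rewrite mulmxDl -scalemxAl mulmxBl /u mulmxDl -!scalemxAl coord//.
  move: (map_mx _ _ *m V) (c *m V) => a b.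
  by apply/rowP => j; rewrite !mxE; field; rewrite gt_eqF ?t0.
have [e eP] := choice H.
have ed k : `|e k| <= delta by have [/le_trans -> //] := eP k; lra.
have gq k : g (harmonic k *: (v0 + (c + e k) *m V) + (1 - harmonic k) *: y) <=
    harmonic k * vertex_bound v0 V g + (1 - harmonic k) * g p.
  have [ek [r qr]] := eP k.
  apply: (frequently_le_limit core cX cf Xy) => //.
  rewrite qr; apply: fgrid; rewrite -qr.
  apply: convex_set_conv => //; first exact: ltW.
  exact: simplex_core_in core cX (ed k).
have h0 := @cvg_harmonic R.
have lim2 : harmonic k * vertex_bound v0 V g + (1 - harmonic k) * g p
    @[k --> \oo] --> 0 * vertex_bound v0 V g + (1 - 0) * g p.
  apply: cvgD; first by apply: cvgM => //; exact: cvg_cst.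
  by apply: cvgM; [apply: cvgB => // |]; exact: cvg_cst.
rewrite mul0r add0r subr0 mul1r in lim2.
apply: (ler_cvg_to (gy harmonic e t0 t1 h0 ed) lim2).
by apply: nearW => k; exact: gq.
Qed.

(** * Dominated convergence along the cone *)

Lemma cone_cvg (R : realType) (d m : nat)
    (v0 : 'rV[R]_d) (V : 'M[R]_(m, d)) (c : 'rV[R]_m)
    (delta : R) (y : 'rV[R]_d) (t : nat -> R) (e : nat -> 'rV[R]_m)
    (q := fun k => t k *: (v0 + (c + e k) *m V) + (1 - t k) *: y) :
  (forall k, 0 < t k) -> (forall k, t k <= 1) ->
  t k @[k --> \oo] --> 0 -> (forall k, `|e k| <= delta) ->
  exists2 M, 0 < M & q k @[k --> \oo] --> y /\ forall k, `|q k - y| <= M.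
Proof.
move=> t0 t1 tcvg ed; have [K K0 VK] := mulmx_norm_bound V.
pose M := `|v0 + c *m V - y| + K * delta + 1.
have de : 0 <= delta by exact: le_trans (normr_ge0 _) (ed 0%N).
have M0 : 0 < M by rewrite ltr_wpDl// addr_ge0// mulr_ge0// ltW.
have qM k : `|q k - y| <= t k * M.
  have -> : q k - y = t k *: ((v0 + c *m V - y) + e k *m V).
    by rewrite /q mulmxDl; apply/rowP => j; rewrite !mxE; ring.
  rewrite normrZ gtr0_norm// ler_pM2l// (le_trans (ler_normD _ _))//.
  have eK : `|e k *m V| <= K * delta.
    by rewrite (le_trans (VK _))// ler_pM2l.
  by rewrite /M; lra.
exists M => //; split => [|k]; last first.
  by rewrite (le_trans (qM k))// ler_piMl// ltW.
apply/cvgrPdistC_le => eps eps0.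
have : t k * M @[k --> \oo] --> 0 * M by apply: cvgM => //; exact: cvg_cst.
rewrite mul0r => /cvgr_lt /(_ eps eps0); apply: filterS => k /ltW.
exact: le_trans (qM k).
Qed.

Lemma integrable_vertex_bound (dPsi : measure_display)
    (Psi : measurableType dPsi) (R : realType)
    (mu : {measure set Psi -> \bar R}) (d m : nat) (v0 : 'rV[R]_d)
    (V : 'M[R]_(m, d)) (F : 'rV[R]_d -> Psi -> R) :
  mu.-integrable setT (EFin \o F v0) ->
  (forall i, mu.-integrable setT (EFin \o F (v0 + row i V))) ->
  mu.-integrable setT (fun z => (vertex_bound v0 V (F ^~ z))%:E).
Proof.
move=> F0 FV.
have -> : (fun z => (vertex_bound v0 V (F ^~ z))%:E) =
    ((abse \o (EFin \o F v0)) \+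
     (fun z => \sum_i (abse \o (EFin \o F (v0 + row i V)%R)) z))%E.
  by apply/funext => z; rewrite /vertex_bound EFinD -sumEFin.
apply: integrableD => //; first exact: integrable_abse.
by apply: integrable_sum => // i _; exact: integrable_abse.
Qed.

(** Convexity supplies the dominating function: from above by the values at [y] and at the vertices,
    from below by reflection through the centre [x0]. Finitely many integrable functions thus
    control the whole sequence. *)
Lemma cvg_Rintegral_core (dPsi : measure_display) (Psi : measurableType dPsi)
    (R : realType) (mu : {measure set Psi -> \bar R}) (d m : nat)
    (X : set 'rV[R]_d) (v0 : 'rV[R]_d) (V : 'M[R]_(m, d)) (A : 'M[R]_(d, m))
    (c : 'rV[R]_m) (delta : R) (F : 'rV[R]_d -> Psi -> R) (y : 'rV[R]_d)
    (t : nat -> R) (e : nat -> 'rV[R]_m)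
    (q := fun k => t k *: (v0 + (c + e k) *m V) + (1 - t k) *: y) :
  simplex_core X v0 V A c delta -> convex_set X -> X y ->
  (forall x, X x -> mu.-integrable setT (EFin \o F x)) ->
  {ae mu, forall z, convex_function X (F ^~ z) /\
                    {within X, continuous (F ^~ z)}} ->
  (forall k, 0 < t k) -> (forall k, t k <= 1) ->
  t k @[k --> \oo] --> 0 -> (forall k, `|e k| <= delta) ->
  \int[mu]_z F (q k) z @[k --> \oo] --> \int[mu]_z F y z.
Proof.
move=> core cX Xy intF aeF t0 t1 tcvg ed; have [d0 Xv0 XV _ _] := core.
have [M M0 [qy qM]] := cone_cvg v0 V c y t0 t1 tcvg ed.
set x0 := v0 + c *m V.
have [K K0 lowK] := simplex_core_lower (M + `|y - x0|) core cX.
have Xh k : X (v0 + (c + e k) *m V) by exact: simplex_core_in core cX (ed k).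
have Xq k : X (q k) by apply: convex_set_conv => //; exact: ltW.
have Xx0 : X x0.
  have := @simplex_core_in _ _ _ _ _ _ _ _ _ 0 core cX.
  by rewrite normr0 addr0; apply; exact: ltW.
pose B z := `|F x0 z| + vertex_bound v0 V (F ^~ z).
(* The [K] part serves the lower bound, the 1 and the term at [y] the upper bound. *)
pose G z := `|F y z| + (K + 1) * B z.
have intG : mu.-integrable setT (EFin \o G).
  have -> : EFin \o G = ((abse \o (EFin \o F y)) \+
      (fun z => (K + 1)%R%:E * ((abse \o (EFin \o F x0)) z +
         (vertex_bound v0 V (F ^~ z))%:E)))%E.
    by apply/funext => z; rewrite /= EFinD EFinM EFinD.
  apply: integrableD => //; first by apply: integrable_abse; exact: intF.
  apply: integrableZl => //; apply: integrableD => //.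
    by apply: integrable_abse; exact: intF.
  by apply: integrable_vertex_bound => [|i]; exact: intF.
have dom k z : convex_function X (F ^~ z) -> `|F (q k) z| <= G z.
  move=> cf.
  have vb0 : 0 <= vertex_bound v0 V (F ^~ z) by rewrite addr_ge0// sumr_ge0.
  have B0 : 0 <= B z by rewrite addr_ge0.
  have F0 := normr_ge0 (F y z).
  rewrite ler_norml; apply/andP; split.
    rewrite lerNl; apply: (@le_trans _ _ (K * B z)); last by rewrite /G; nra.
    apply: lowK => //.
    rewrite -(subrKA y) (le_trans (ler_normD _ _))// lerD2r//; exact: qM.
  have [_ fh] := simplex_core_convex core cX cf (ed k).
  apply: le_trans (convex_function_conv cf (ltW (t0 k)) (t1 k) (Xh k) Xy) _.
  apply: (@le_trans _ _ (B z + `|F y z|)); last by rewrite /G; nra.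
  rewrite lerD//.
    apply: (@le_trans _ _ (t k * vertex_bound v0 V (F ^~ z))).
      by rewrite ler_pM2l.
    apply: (@le_trans _ _ (vertex_bound v0 V (F ^~ z))).
      by rewrite ler_piMl.
    by rewrite lerDr.
  have s0 : 0 <= 1 - t k by rewrite subr_ge0.
  apply: (@le_trans _ _ ((1 - t k) * `|F y z|)).
    by rewrite ler_wpM2l// ler_norm.
  by rewrite ler_piMl// lerBlDr lerDl ltW.
have aecvg : {ae mu, forall z, setT z ->
    (F (q k) z)%:E @[k --> \oo] --> (F y z)%:E}.
  apply: filterS aeF => z [_ /subspace_continuousP/(_ y Xy) Fy] _.
  apply: cvg_EFin; first exact: nearW.
  (* Continuity holds only within [X], hence the use of [Xq]. *)
  move=> S /Fy /qy; apply: (@filterS _ \oo) => k /=; apply; exact: Xq.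
have aedom : {ae mu, forall z k, setT z -> (`|(F (q k) z)%:E| <= (G z)%:E)%E}.
  by apply: filterS aeF => z [cf _] k _; rewrite lee_fin; exact: dom.
have [_ _] := dominated_convergence measurableT
  (fun k => measurable_int _ (intF _ (Xq k))) (measurable_int _ (intF _ Xy))
  aecvg intG aedom.
move=> cvgI; apply: fine_cvg.
rewrite fineK//; exact: integrable_fin_num (intF _ Xy).
Qed.

(** * Deterministic convergence of minimizers *)

(** Inside a ball around [p] contained in [U], the set agrees with the closed set [C]; a small
    enough sphere therefore cuts it in a closed bounded set. *)
Lemma locally_closed_sphere (R : realType) (d : nat) (X : set 'rV[R]_d)
    (p : 'rV[R]_d) (eps : R) :
  locally_closed X -> X p -> 0 < eps ->
  exists2 rho, 0 < rho < eps & compact (X `&` [set x | `|x - p| = rho]).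
Proof.
move=> [U [C [oU cC ->]]] [Up Cp] eps0.
have /nbhs_ballP[r /= r0 rU] := open_nbhs_nbhs (conj oU Up).
pose rho := Num.min eps r / 2.
have m0 : 0 < Num.min eps r by rewrite lt_min eps0.
have rho0 : 0 < rho by rewrite divr_gt0.
have rhom : rho < Num.min eps r by rewrite /rho; lra.
have [rhoe rhor] : rho < eps /\ rho < r by move: rhom; rewrite lt_min => /andP.
exists rho; first by rewrite rho0.
have -> : U `&` C `&` [set x | `|x - p| = rho] =
    C `&` (fun x => `|x - p|) @^-1` [set rho].
  apply/seteqP; split=> x /=; first by move=> [[_ ?] ?].
  move=> [Cx xp]; split => //; split => //; apply: rU.
  by rewrite -ball_normE /= distrC xp.
apply: bounded_closed_compact.
  exists (rho + `|p|); split => [|M Mlt x [_ xp]]; first exact: num_real.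
  rewrite /= -(subrK p x) (le_trans (ler_normD _ _))//.
  by move: xp => /= ->; exact: ltW.
apply: closedI => //; apply: closed_comp; last exact: closed_eq.
move=> x _; apply: (@cvg_norm _ _ _ (nbhs x) _ (fun u => u - p)).
by apply: cvgB; [exact: cvg_id | exact: cvg_cst].
Qed.

(** The minimizers may be unbounded, so compactness is applied to their pullbacks on a small sphere
    around [p]. The last hypothesis, which excludes cluster points other than [p], is where
    uniqueness of the limit problem enters. *)
Lemma cvg_argmin (R : realType) (d : nat) (X : set 'rV[R]_d)
    (f : nat -> 'rV[R]_d -> R) (x : nat -> 'rV[R]_d) (p : 'rV[R]_d) :
  convex_set X -> locally_closed X -> X p ->
  (forall n, (0 < n)%N -> convex_function X (f n)) ->
  (forall n, (0 < n)%N -> argmin X (f n) (x n)) ->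
  (forall y, X y ->
    (forall eta N, 0 < eta -> exists n y',
      [/\ (N <= n)%N, X y', `|y - y'| < eta & f n y' <= f n p]) -> y = p) ->
  x n @[n --> \oo] --> p.
Proof.
move=> cX lcX Xp cf xmin uniq; apply/cvgrPdistC_lt => eps eps0.
have [rho /andP[rho0 rhoe] cK] := locally_closed_sphere lcX Xp eps0.
apply: contrapT => Hfar.
have far N : exists n, [/\ (N <= n)%N, (0 < n)%N & rho <= `|x n - p|].
  apply: contrapT => /forallNP near_p; apply: Hfar.
  exists N.+1 => // n /= Nn; rewrite (le_lt_trans _ rhoe)// leNgt.
  apply/negP => /ltW le_n; apply: (near_p n).
  by split => //; [exact: ltnW | exact: leq_trans Nn].
have [s sP] := choice far.
pose z N := (rho / `|x (s N) - p|) *: x (s N) + (1 - rho / `|x (s N) - p|) *: p.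
have zP N : [/\ X (z N), `|z N - p| = rho & f (s N) (z N) <= f (s N) p].
  have [_ s0 le_rho] := sP N.
  have n0 : 0 < `|x (s N) - p| by exact: lt_le_trans le_rho.
  have [Xx xm] := xmin _ s0.
  have l0 : 0 <= rho / `|x (s N) - p| by rewrite divr_ge0// ltW.
  have l1 : rho / `|x (s N) - p| <= 1 by rewrite ler_pdivrMr// mul1r.
  split; first exact: convex_set_conv.
    have -> : z N - p = (rho / `|x (s N) - p|) *: (x (s N) - p).
      by rewrite /z; apply/rowP => j; rewrite !mxE; ring.
    by rewrite normrZ ger0_norm// divfK// gt_eqF.
  apply: le_trans (convex_function_conv (cf _ s0) l0 l1 Xx Xp) _.
  have := ler_wpM2l l0 (xm p Xp); lra.
have [|y [[Xy yp] yclus]] := cK (z @ \oo) _.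
  by exists 0%N => // N _; have [? ? _] := zP N.
suff yE : y = p by move: yp => /=; rewrite yE subrr normr0; lra.
apply: uniq => // eta N eta0.
(* A cluster point meets the image of every tail, which gives indices beyond any [N]. *)
have [_ [[k /= Nk <-] yk]] := yclus (z @` [set k | (N <= k)%N]) (ball y eta)
  ltac:(by exists N => // k Nk; exists k) (nbhsx_ballx y eta eta0).
have [sk _ _] := sP k; have [Xz _ fz] := zP k.
exists (s k), (z k); split => //; first exact: leq_trans sk.
by move: yk; rewrite -ball_normE.
Qed.

(** * Almost sure convergence of the decisions *)

Lemma convex_avg_cost (R : realType) (d : nat) (T Psi : Type)
    (X : set 'rV[R]_d) (F : 'rV[R]_d -> T -> Psi -> R)
    (w : forall n, T -> ('I_n -> T) -> 'I_n -> R)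
    (S_ : nat -> T) (Z_ : nat -> Psi) (n : nat) (s : T) :
  (forall i, 0 <= w n s (fun j => S_ j) i) ->
  (forall i, convex_function X (fun x => F x (S_ i) (Z_ i.+1))) ->
  convex_function X (avg_cost F w S_ Z_ n s).
Proof.
move=> w0 cF t x y Xx Xy; rewrite convRE /avg_cost !mulr_sumr -big_split /=.
apply: ler_sum => i _; rewrite mulrCA [X in _ + X]mulrCA -mulrDr.
by apply: ler_wpM2l => //; exact: cF.
Qed.

Theorem theorem3p1 (R : realType) (d : nat) (X : set 'rV[R]_d)
    (T : ptopologicalType) (SD : set T)
    (dO dPsi : measure_display)
    (Omega : measurableType dO) (Psi : measurableType dPsi)
    (P : probability Omega R)
    (F : 'rV[R]_d -> T -> Psi -> R)
    (S : {RV P >-> borel T}) (Z : {RV P >-> Psi})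
    (Q : R.-pker (borel T) ~> Psi)
    (S_ : nat -> {RV P >-> borel T}) (Z_ : nat -> {RV P >-> Psi})
    (w : forall n, T -> ('I_n -> T) -> 'I_n -> R)
    (xn : nat -> T -> Omega -> 'rV[R]_d) (xstar : T -> 'rV[R]_d)
    (Fbar := fun n s omega => avg_cost F w (S_ ^~ omega) (Z_ ^~ omega) n s)
    (Fcond := cond_cost Q F) :
  convex_set X ->
  (* needed: the conclusion can fail for e.g. X = {x2 > 0} U {0} in R^2 *)
  locally_closed X ->
  compact SD ->
  conditional_law S Z Q ->
  (* the conditional expectation F(x|s) is well defined *)
  (forall s x, SD s -> X x -> (Q s).-integrable setT (EFin \o F x s)) ->
  (forall n s omega i, (0 < n)%N -> 0 <= w n s (fun j => S_ j omega) i) ->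
  (forall n s omega, (0 < n)%N ->
     \sum_(i < n) w n s (fun j => S_ j omega) i = 1) ->
  (forall i omega, convex_function X (fun x => F x (S_ i omega) (Z_ i.+1 omega))) ->
  (forall s, SD s ->
     {ae Q s, forall z, convex_function X (fun x => F x s z) /\
                        {within X, continuous (fun x => F x s z)}}) ->
  (forall s x, SD s -> X x ->
     {ae P, forall omega, Fbar n s omega x @[n --> \oo] --> Fcond s x}) ->
  (forall s, SD s -> exists! x, argmin X (Fcond s) x) ->
  (forall n s omega, (0 < n)%N -> SD s ->
     argmin X (Fbar n s omega) (xn n s omega)) ->
  (forall s, SD s -> argmin X (Fcond s) (xstar s)) ->
  forall s, SD s ->
    {ae P, forall omega, xn n s omega @[n --> \oo] --> xstar s}.
Proof.
move=> cX lcX _ _ intF w0 _ cF aeF cvgF uniq xnmin xsmin s SDs.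
have [Xp pmin] := xsmin s SDs.
have [m [V [A [c [delta core]]]]] := exists_simplex_core Xp.
pose v r := xstar s + map_mx ratr r *m V.
have grid : {ae P, forall omega, forall r : 'rV[rat]_m, X (v r) ->
    Fbar n s omega (v r) @[n --> \oo] --> Fcond s (v r)}.
  (* The grid is countable; enumerating it by [unpickle] turns the quantifier over [r] into one over
     [nat], so a single null set covers all grid points. *)
  have : {ae P, forall omega, forall k, forall r : 'rV[rat]_m,
      unpickle k = Some r -> X (v r) ->
      Fbar n s omega (v r) @[n --> \oo] --> Fcond s (v r)}.
    apply: ae_foralln => k; case: (unpickle k) => [r|]; last first.
      by apply: aeW => omega r.
    have [Xr|NXr] := pselect (X (v r)); last first.
      by apply: aeW => omega _ [<-].
    by apply: filterS (cvgF s (v r) SDs Xr) => omega Hr _ [<-].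
  apply: filterS => omega H r; exact: H (pickleK r).
apply: filterS2 grid (cvgF s _ SDs Xp) => omega grid fp.
have cfn n : (0 < n)%N -> convex_function X (Fbar n s omega).
  move=> n0; apply: convex_avg_cost => i; [exact: w0 | exact: cF].
apply: (cvg_argmin cX lcX Xp cfn (fun n n0 => xnmin n s omega n0 SDs)).
move=> y Xy freq.
(* It suffices that the limit cost at [y] is at most that at [xstar s]: then [y] is a minimizer too,
   and both equal [z]. *)
have [z [zmin zuniq]] := uniq s SDs.
rewrite -(zuniq _ (xsmin s SDs)); apply/esym/zuniq.
split => // u Xu; apply: le_trans (pmin u Xu).
apply: (epi_limit_le core cX _ Xy grid fp _ freq).
  by exists 1%N => // n /= n0; exact: cfn.
move=> t e t0 t1 tcvg ed.
exact: (cvg_Rintegral_core core cX Xy (fun x => intF s x SDs) (aeF s SDs)).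
Qed.
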